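(* Let $G=(V,E)$ be a finite simple graph with $n=|V|$. At any step $s$ of the Wavefront algorithm (described in the context) applied to $G$, \[|\mathcal{C}|\le \sum_{i=1}^{s}\binom{n}{i},\] and this bound is tight.
   Context: For $v\in V$, $N(v)$ is the neighborhood of $v$ and $N[v]=N(v)\cup\{v\}$. Zero forcing color change rule: a colored vertex with exactly one uncolored neighbor forces that neighbor to become colored. The closure $\mathrm{cl}(S)$ of $S\subseteq V$ is the set of colored vertices obtained from $S$ by applying the rule until no further vertex can be forced. Wavefront algorithm: initialize $\mathcal{C}\leftarrow\{(\emptyset,0)\}$. For $R=1,2,\dots,n$ (the iteration with $R=s$ is step $s$): for each $(S,r)\in\mathcal{C}$: for each $v\in V$: set $S'\leftarrow \mathrm{cl}(S\cup N[v])$ and $r'\leftarrow r+|\{v\}\setminus S|+\max\{|N(v)\setminus S|-1,0\}$; if $r'\le R$ and there is no pair $(S',i)\in\mathcal{C}$ with $i\le R$, then add $(S',r')$ to $\mathcal{C}$, and if moreover $S'=V$, return $r'$.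
   Formalization: The bound and its tightness are stated for 𝒞 without the initial pair (∅,0); the bound on |𝒞| itself is stated only for graphs with an edge, since for edgeless graphs |𝒞| exceeds the sum by one at the end of step s. *)

(* Defs.v *)
From mathcomp Require Import all_boot.
From mathcomp Require Import finmap.

Set Implicit Arguments.
Unset Strict Implicit.
Unset Printing Implicit Defensive.

Local Open Scope fset_scope.
Local Open Scope nat_scope.

Section Wavefront.

(* The graph is (V, e); statements assume e symmetric and irreflexive. *)
Variables (V : finType) (e : rel V).

Definition nbh (v : V) : {set V} := [set w | e v w].

Definition cnbh (v : V) : {set V} := v |: nbh v.

Definition forces (S : {set V}) (u w : V) : bool :=
  (u \in S) && (nbh u :\: S == [set w]).

Definition force_round (S : {set V}) : {set V} :=
  S :|: [set w | [exists u, forces S u w]].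

(* All currently possible forces are performed in each round.  A force that is
   available stays available, or becomes void, when more vertices are colored,
   so the final set does not depend on the order of the forces; a round that is
   not stationary colors a new vertex, so #|V| rounds suffice. *)
Definition cl (S : {set V}) : {set V} := iter #|V| force_round S.

Definition wpair : choiceType := ({set V} * nat)%type.

Definition front := {fset wpair}.

(* The current value of the collection, and the returned value, if any. *)
Definition wstate := (front * option nat)%type.

Definition new_set (p : wpair) (v : V) : {set V} := cl (p.1 :|: cnbh v).

(* Truncated subtraction: #|A| - 1 is max{|A| - 1, 0}. *)
Definition new_cost (p : wpair) (v : V) : nat :=
  p.2 + #|[set v] :\: p.1| + (#|nbh v :\: p.1| - 1).

(* The body of the inner loop; nothing is executed after a return. *)
Definition visit (R : nat) (st : wstate) (w : wpair * V) : wstate :=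
  if st.2 is Some _ then st else
  let S' := new_set w.1 w.2 in
  let r' := new_cost w.1 w.2 in
  if (r' <= R) && ~~ [exists i : 'I_R.+1, (S', val i) \in st.1]
  then ((S', r') |` st.1, if S' == [set: V] then Some r' else None)
  else st.

Definition visits (R : nat) (st : wstate) (ws : seq (wpair * V)) : wstate :=
  foldl (visit R) st ws.

(* A schedule is an order in which the two nested loops of one step may run,
   the outer one ranging over the collection C found on entering the step.
   No order is prescribed, and the order on V may change from pair to pair. *)
Definition schedule (C : front) (ws : seq (wpair * V)) : Prop :=
  exists (ps : seq wpair) (vs : wpair -> seq V),
    [/\ perm_eq ps (enum_fset C),
        forall p, perm_eq (vs p) (enum V)
      & ws = [seq (p, v) | p <- ps, v <- vs p]].

(* The states in which the algorithm can be after completing step R, the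
   state for R = 0 being the initial one. *)
Inductive after_step : nat -> wstate -> Prop :=
| After_init : after_step 0 ([fset ((set0, 0) : wpair)], None)
| After_next R C ws :
    R < #|V| -> after_step R (C, None) -> schedule C ws ->
    after_step R.+1 (visits R.+1 (C, None) ws).

(* C is a value taken by the collection at some moment of step s, from its
   beginning to its end. *)
Definition at_step (s : nat) (C : front) : Prop :=
  exists (C0 : front) (ws : seq (wpair * V)) (k : nat),
    [/\ 0 < s <= #|V|, after_step s.-1 (C0, None), schedule C0 ws
      & C = (visits s (C0, None) (take k ws)).1].

End Wavefront.

(* Main.v *)
Require Import Defs.
From mathcomp Require Import all_boot.
From mathcomp Require Import finmap.

(** Every pair [(S, r)] of the collection satisfies [S = cl B] for some [B] with
    at most [r] vertices: to extend [S = cl B] by [cnbh v], add to [B] the vertex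
    [v] and all but one of its neighbors outside [S]; the last one is forced by
    [v].  A set occurs at most once in the collection, so the collection without
    [(set0, 0)] injects into the closures of the nonempty sets of at most [s]
    vertices.  An edge frees one more slot, for [(set0, 0)]: of its two ends,
    either one has degree at least 2, and then its singleton, although closed, is
    never reached, or both have degree 1, and their singletons have the same
    closure.  In the edgeless graph all sets are closed and the cost of a set is
    its size, so every nonempty set of size at most [s] is reached by step [s]. *)

Local Open Scope fset_scope.
Local Open Scope nat_scope.

(** * Closure under zero forcing *)

Section Closure.

Set Implicit Arguments.
Unset Strict Implicit.

Variables (V : finType) (e : rel V).
Implicit Types (S T B : {set V}) (u v w : V).

Lemma sub_force_round S : S \subset force_round e S.
Proof. exact: subsetUl. Qed.

Lemma force_roundS S T :
  S \subset T -> force_round e S \subset force_round e T.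
Proof.
move=> sST; rewrite subUset (subset_trans sST (sub_force_round T)) /=.
apply/subsetP=> w; rewrite !inE => /existsP[u /andP[Su /eqP defw]].
case: (boolP (w \in T)) => //= wNT; apply/existsP; exists u.
have /setDP[wN _] : w \in nbh e u :\: S by rewrite defw set11.
rewrite /forces (subsetP sST) //= eqEsubset sub1set inE wNT wN -defw.
by rewrite andbT setDS.
Qed.

Lemma iter_force_roundS k S T :
  S \subset T -> iter k (force_round e) S \subset iter k (force_round e) T.
Proof. by move=> sST; elim: k => //= k; apply: force_roundS. Qed.

Lemma clS S T : S \subset T -> cl e S \subset cl e T.
Proof. exact: iter_force_roundS. Qed.

Lemma iter_force_round_id k S :
  force_round e S = S -> iter k (force_round e) S = S.
Proof. by move=> fS; elim: k => //= k ->. Qed.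

Lemma sub_cl S : S \subset cl e S.
Proof.
rewrite /cl; elim: #|V| => //= k IH.
exact: subset_trans IH (sub_force_round _).
Qed.

Lemma force_round_cl S : force_round e (cl e S) = cl e S.
Proof.
(* Generalized to [k] rounds: either the set is stationary, or one more round yields more than [k]
   vertices. *)
suff [//|] : force_round e (cl e S) = cl e S \/ #|V| < #|force_round e (cl e S)|.
  by rewrite ltnNge max_card.
rewrite /cl; elim: #|V| => [|k [IH|IH]] /=; last 1 first.
- have [fE|fN] := eqVneq (force_round e (iter k.+1 (force_round e) S))
                         (iter k.+1 (force_round e) S); first by left.
  right; apply: leq_ltn_trans IH (proper_card _).
  by rewrite properEneq eq_sym fN sub_force_round.
- have [fE|fN] := eqVneq (force_round e S) S; first by left.
  right; apply: leq_ltn_trans (leq0n _) (proper_card (_ : S \proper _)).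
  by rewrite properEneq eq_sym fN sub_force_round.
by left; rewrite IH.
Qed.

Lemma clK S : cl e (cl e S) = cl e S.
Proof. exact: iter_force_round_id (force_round_cl S). Qed.

Lemma cl_sub S T : S \subset cl e T -> cl e S \subset cl e T.
Proof. by move=> /clS; rewrite clK. Qed.

Lemma cl_set0 : cl e set0 = set0.
Proof.
apply: iter_force_round_id; apply/setP=> w; rewrite !inE /=.
by apply/existsP=> -[u]; rewrite /forces inE.
Qed.

(** Otherwise [w] would be the only uncolored neighbor of [v], hence forced, although the closure is
    stationary. *)
Lemma nbh_sub_cl S v w :
  v \in cl e S -> nbh e v \subset w |: cl e S -> nbh e v \subset cl e S.
Proof.
move=> vS sN; case: (boolP (w \in cl e S)) => [wS|wNS].
  by move: sN; rewrite setUC (setUidPl _) // sub1set.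
case: (boolP (w \in nbh e v)) => [wN|wNN]; last first.
  apply/subsetP=> x xN; have := subsetP sN x xN; rewrite in_setU1.
  by case: eqP => // xw; rewrite -xw xN in wNN.
case/negP: (wNS); rewrite -force_round_cl inE; apply/orP; right.
rewrite inE; apply/existsP; exists v; rewrite /forces vS /=.
rewrite eqEsubset sub1set inE wNS wN !andbT.
apply/subsetP=> x /setDP[xN xNS]; have := subsetP sN x xN.
by rewrite in_setU1 (negPf xNS) orbF in_set1.
Qed.

(** As [u] is not its own neighbor, it can force only if its neighborhood is a singleton, which must
    then be [[set v]]. *)
Lemma cl_set1 u v :
  irreflexive e -> e u v -> nbh e u != [set v] -> cl e [set u] = [set u].
Proof.
move=> irre uv Nu; apply: iter_force_round_id; apply/setUidPl/subsetP=> w.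
rewrite inE => /existsP[x /andP[/set1P-> /eqP defw]].
have NuE : nbh e u :\: [set u] = nbh e u.
  by apply/setDidPl; rewrite disjoint_sym disjoints1 inE irre.
have : v \in nbh e u by rewrite inE.
by rewrite -NuE defw => /set1P vw; rewrite -NuE defw vw eqxx in Nu.
Qed.

Lemma cl_leaf u v : nbh e u = [set v] -> v \in cl e [set u].
Proof.
move=> Nu; apply: (subsetP (@nbh_sub_cl [set u] u v _ _)).
- by rewrite (subsetP (sub_cl _)) // set11.
- by rewrite Nu subsetUl.
by rewrite Nu set11.
Qed.

End Closure.

(** * Invariants of a run *)

Section Bound.

Set Implicit Arguments.
Unset Strict Implicit.

Variables (V : finType) (e : rel V).
Implicit Types (S B : {set V}) (u v w : V) (p q : wpair V) (C : front V).

(** The second clause makes the initial pair the only one with an empty set, and keeps the singleton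
    of a vertex that has a neighbor out of the collection. *)
Definition reached p : Prop :=
  (exists2 B, cl e B = p.1 & #|B| <= p.2) /\
  (p = (set0, 0) \/ exists v, cnbh e v \subset p.1).

Lemma reached_new p v :
  reached p -> reached (new_set e p v, new_cost e p v).
Proof.
case: p => S r [[B /= clB leB] _]; split=> /=; last first.
  right; exists v; apply: subset_trans (sub_cl e _); exact: subsetUr.
set N := nbh e v :\: S.
(* [w] is the neighbor left for [v] to force; if [N] is empty, any vertex serves. *)
have [w cardNw] : exists w, #|N :\ w| <= #|N| - 1.
  have [->|[w wN]] := set_0Vmem N; first by exists v; rewrite set0D cards0.
  by exists w; rewrite (cardsD1 w N) wN add1n subn1.
(* The sizes of the three parts are bounded by the three terms of [new_cost]. *)
exists (B :|: ([set v] :\: S) :|: (N :\ w)); last first.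
  rewrite /new_cost /=; apply: leq_trans (leq_card_setU _ _) _.
  rewrite leq_add //; apply: leq_trans (leq_card_setU _ _) _.
  by rewrite leq_add2r.
set B' := _ :|: _; have sSB' : S \subset cl e B'.
  by rewrite -clB clS // /B' -setUA subsetUl.
have sB'cl := sub_cl e B'.
have vB' : v \in cl e B'.
  have [/(subsetP sSB') //|vNS] := boolP (v \in S).
  by apply: (subsetP sB'cl); rewrite !inE eqxx vNS orbT.
apply/eqP; rewrite eqEsubset; apply/andP; split.
  apply: clS; apply/subsetP=> x; rewrite !inE.
  case/orP=> [/orP[xB|/andP[_ ->]]|/and3P[_ _ ->]]; rewrite ?orbT //.
  by rewrite -clB (subsetP (sub_cl e B)).
apply: cl_sub; rewrite subUset sSB' subUset sub1set vB' /=.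
apply: (@nbh_sub_cl _ _ _ _ w) vB' _; apply/subsetP=> x xv; rewrite in_setU1.
have [//|xw] := eqVneq x w; have [/(subsetP sSB') //|xNS] := boolP (x \in S).
by apply: (subsetP sB'cl); rewrite /B' in_setU /N !in_setD in_set1 xw xNS xv orbT.
Qed.

(** One cost per set makes the first projection injective on [C], so that counting pairs is counting
    sets. *)
Definition reached_front R C : Prop :=
  (forall p, p \in C -> reached p /\ p.2 <= R) /\
  (forall p q, p \in C -> q \in C -> p.1 = q.1 -> p = q).

Lemma reached_visit R st (w : wpair V * V) :
  reached_front R st.1 -> reached w.1 -> reached_front R (visit e R st w).1.
Proof.
case: st w => C o [p v] [/= RC injC] Rp; rewrite /visit /=.
case: o => [//|]; case: ifP => //= /andP[ler /existsP newN].
(* The membership test inspects only costs up to [R], but no cost in [C] exceeds [R], so it detects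
   every occurrence of the set. *)
have newC q : q \in C -> q.1 != new_set e p v.
  case: q => S i qC; apply/eqP=> /= defS; apply: newN.
  by have [_ /= lei] := RC _ qC; exists (Ordinal (lei : i < R.+1)); rewrite -defS.
split=> [q|q1 q2]; rewrite !inE.
  by case/orP=> [/eqP->|/RC //]; split=> //; exact: reached_new.
case/orP=> [/eqP->|q1C] /orP[/eqP->|q2C] //=; last exact: injC.
  by move=> E; have := newC _ q2C; rewrite -E eqxx.
by move=> E; have := newC _ q1C; rewrite E eqxx.
Qed.

Lemma reached_visits R st (ws : seq (wpair V * V)) :
  reached_front R st.1 -> (forall x, x \in ws -> reached x.1) ->
  reached_front R (visits e R st ws).1.
Proof.
elim: ws st => //= w ws IH st Rst Rws; apply: IH => [|x xws].
  by apply: reached_visit => //; apply: Rws; rewrite mem_head.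
by apply: Rws; rewrite inE xws orbT.
Qed.

Lemma mem_schedule C (ws : seq (wpair V * V)) :
  schedule C ws -> ws =i [pred w | w.1 \in C].
Proof.
case=> ps [vs [eps evs ->]] [p v]; rewrite inE /=.
apply/allpairsPdep/idP => [[x [y [xps _ [-> _]]]]|pC].
  by rewrite (perm_mem eps) in xps.
exists p, v; split=> //; first by rewrite (perm_mem eps).
by rewrite (perm_mem (evs p)) mem_enum.
Qed.

Lemma reached_front_leq R R' C :
  R <= R' -> reached_front R C -> reached_front R' C.
Proof.
by move=> leR [RC injC]; split=> // p /RC[Rp /leq_trans->].
Qed.

Lemma reached_after_step R st : after_step e R st -> reached_front R st.1.
Proof.
elim=> {R st} [|R C ws _ _ RC sch]; last first.
  apply: reached_visits => [|w]; first exact: reached_front_leq RC.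
  by rewrite (mem_schedule sch) => /RC.1[].
split=> [p|p q]; rewrite !inE => /eqP->; last by move/eqP->.
split=> //; split; last by left.
by exists set0; rewrite ?cards0 //=; exact: cl_set0.
Qed.

Lemma reached_at_step s C : at_step e s C -> reached_front s C.
Proof.
case=> C0 [ws [k [_ C0s sch ->]]].
have RC0 := reached_after_step C0s.
apply: reached_visits => [|w /mem_take].
  exact: reached_front_leq (leq_pred s) RC0.
by rewrite (mem_schedule sch) => /RC0.1[].
Qed.

(** * Counting the collection *)

Definition small_sets s : {set {set V}} := [set B : {set V} | 0 < #|B| <= s].

Lemma card_small_sets s :
  #|small_sets s| = \sum_(1 <= i < s.+1) 'C(#|V|, i).
Proof.
elim: s => [|s IH].
  rewrite big_geq //; apply: eq_card0 => B.
  by rewrite inE; case: #|B|.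
rewrite big_nat_recr //= -IH -card_draws.
have -> : small_sets s.+1 = small_sets s :|: [set B : {set V} | #|B| == s.+1].
  apply/setP=> B; rewrite !inE (leq_eqVlt _ s.+1) ltnS andb_orr orbC.
  by case: eqP => [->|_]; rewrite ?andbF ?andbT.
rewrite cardsU; set I := _ :&: _; suff -> : I = set0 by rewrite cards0 subn0.
apply/setP=> B; rewrite !inE.
by case: eqP => [->|_]; rewrite ?ltnn ?andbF.
Qed.

(** [D] will be either all small sets or these without one singleton. *)
Lemma reached_card s C (D : {set {set V}}) :
  reached_front s C ->
  (forall p, p \in C -> p.1 != set0 -> p.1 \in cl e @: D) ->
  #|` C `\ ((set0, 0) : wpair V)| <= #|D|.
Proof.
move=> [RC injC] sub; apply: leq_trans (leq_imset_card (cl e) D).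
rewrite cardE -(size_map (fun p : wpair V => p.1)); apply: uniq_leq_size.
  rewrite map_inj_in_uniq ?fset_uniq // => p q.
  by rewrite !in_fsetD1 => /andP[_ pC] /andP[_ qC]; exact: injC.
move=> S /mapP[p]; rewrite in_fsetD1 mem_enum => /andP[pN0 pC] ->.
apply: sub => //; have [[_ [p0|[v sv]]] _] := RC _ pC.
  by rewrite p0 eqxx in pN0.
by apply/set0Pn; exists v; rewrite (subsetP sv) // setU11.
Qed.

Lemma reached_small s C p :
  reached_front s C -> p \in C -> p.1 != set0 -> p.1 \in cl e @: small_sets s.
Proof.
move=> [RC _] pC pN0; have [[[B clB leB] _] les] := RC _ pC.
rewrite -clB imset_f // inE (leq_trans leB les) andbT card_gt0.
by apply: contraNneq pN0 => B0; rewrite -clB B0 cl_set0.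
Qed.

Lemma reached_bound s C :
  reached_front s C ->
  #|` C `\ ((set0, 0) : wpair V)| <= \sum_(1 <= i < s.+1) 'C(#|V|, i).
Proof.
move=> RC; rewrite -card_small_sets; apply: reached_card (RC) _ => p pC.
exact: (@reached_small s C p RC pC).
Qed.

(** Without [[set v]] the small sets still generate every nonempty collected set; the freed slot
    pays for [(set0, 0)]. The hypothesis on [v] holds vacuously when the closure of [[set v]] is
    never collected. *)
Lemma reached_bound_drop s C v :
  0 < s -> reached_front s C ->
  (forall p, p \in C -> p.1 = cl e [set v] -> exists2 u, u != v & p.1 = cl e [set u]) ->
  #|` C| <= \sum_(1 <= i < s.+1) 'C(#|V|, i).
Proof.
move=> s_gt0 RC drop; have v_small u : [set u] \in small_sets s.
  by rewrite inE cards1.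
apply: leq_trans (_ : 1 + #|` C `\ ((set0, 0) : wpair V)| <= _).
  by rewrite (cardfsD1 (set0, 0)) leq_add2r leq_b1.
rewrite -card_small_sets (cardsD1 [set v]) v_small leq_add2l.
apply: reached_card (RC) _ => p pC pN0.
have /imsetP[B Bs defp] := @reached_small s C p RC pC pN0.
have [Bv|BNv] := eqVneq B [set v]; last first.
  by rewrite defp imset_f // in_setD1 BNv.
rewrite Bv in defp; have [u uNv ->] := drop p pC defp.
by rewrite imset_f // in_setD1 v_small (inj_eq set1_inj) uNv.
Qed.

Lemma reached_bound_edge s C :
  symmetric e -> irreflexive e -> 0 < s -> reached_front s C ->
  (exists u v, e u v) -> #|` C| <= \sum_(1 <= i < s.+1) 'C(#|V|, i).
Proof.
move=> syme irre s_gt0 RC [u [v uv]].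
have uNv : u != v by apply: contraTneq uv => ->; rewrite irre.
have [clE|clN] := eqVneq (cl e [set u]) (cl e [set v]).
  by apply: (@reached_bound_drop _ _ v) => // p _ ->; exists u.
(* Here [[set x]] is closed; if collected, it would contain a closed neighborhood, necessarily that
   of [x], and hence [y]. *)
have drop x y : e x y -> nbh e x != [set y] ->
    #|` C| <= \sum_(1 <= i < s.+1) 'C(#|V|, i).
  move=> xy /(cl_set1 irre xy) clx; apply: (@reached_bound_drop _ _ x) => // p pC.
  rewrite clx => defp; have [[_ [p0|[w sw]]] _] := RC.1 _ pC.
    by have := set11 x; rewrite -defp p0 inE.
  move: sw; rewrite defp subUset sub1set => /andP[/set1P-> /subsetP/(_ y)].
  by rewrite !inE => /(_ xy) /eqP yx; rewrite yx irre in xy.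
(* If [drop] applies to neither end, the edge is isolated and its ends force each other, contrary to
   [clN]. *)
have [Nu|/drop-> //] := eqVneq (nbh e u) [set v].
have [Nv|/drop-> //] := eqVneq (nbh e v) [set u]; last by rewrite syme.
case/eqP: clN; apply/eqP; rewrite eqEsubset.
by rewrite !cl_sub // sub1set cl_leaf.
Qed.

End Bound.

(** * Tightness: the edgeless graph *)

Section Edgeless.

Set Implicit Arguments.
Unset Strict Implicit.

Variable V : finType.
Implicit Types (S : {set V}) (v : V) (p : wpair V) (C : front V).

Definition edgeless : rel V := fun _ _ => false.

Lemma nbh_edgeless v : nbh edgeless v = set0.
Proof. by apply/setP=> w; rewrite !inE. Qed.

Lemma cl_edgeless S : cl edgeless S = S.
Proof.
apply: iter_force_round_id; apply/setUidPl/subsetP=> w.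
rewrite inE => /existsP[u /andP[_]].
by rewrite nbh_edgeless set0D eq_sym -cards_eq0 cards1.
Qed.

Lemma new_set_edgeless p v : new_set edgeless p v = v |: p.1.
Proof. by rewrite /new_set cl_edgeless /cnbh nbh_edgeless setU0 setUC. Qed.

Lemma new_cost_edgeless p v :
  p.2 = #|p.1| -> new_cost edgeless p v = #|v |: p.1|.
Proof.
move=> costp; rewrite /new_cost costp nbh_edgeless set0D cards0 addn0 cardsU1.
rewrite addnC; congr (_ + _); have [vp|vNp] := boolP (v \in p.1).
  by apply/eqP; rewrite cards_eq0 setD_eq0 sub1set.
rewrite (setDidPl _) ?cards1 //.
by rewrite disjoints1.
Qed.

(** Together the clauses exclude an early return: a return within step [R] implies [#|V| <= R]. *)
Definition size_cost R (st : wstate V) : Prop :=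
  (forall p, p \in st.1 -> p.2 = #|p.1| /\ p.2 <= R) /\
  (st.2 <> None -> ([set: V], #|V|) \in st.1).

Lemma size_cost_visit R st (w : wpair V * V) :
  size_cost R st -> w.1.2 = #|w.1.1| ->
  [/\ size_cost R (visit edgeless R st w),
      {subset st.1 <= (visit edgeless R st w).1}
    & #|w.2 |: w.1.1| <= R ->
      (visit edgeless R st w).2 = None ->
      (w.2 |: w.1.1, #|w.2 |: w.1.1|) \in (visit edgeless R st w).1].
Proof.
case: st w => C o [p v] [/= costC doneC] costp; rewrite /visit /=.
case: o doneC => [o|] doneC; first by split.
rewrite new_cost_edgeless // new_set_edgeless; set S := v |: p.1.
case: ifP => [/andP[leR _]|newN] /=; split=> //=.
- split=> [q|] /=.
    by rewrite !inE => /orP[/eqP->|/costC].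
  by case: eqP => // -> _; rewrite cardsT !inE eqxx.
- by move=> q qC; rewrite !inE qC orbT.
- by rewrite !inE eqxx.
(* A set of affordable cost is rejected only if already present, and then its recorded cost is its
   size. *)
move=> leR _; move/negbT: newN; rewrite leR negbK => /existsP[i iC].
by have [/= <- _] := costC _ iC.
Qed.

Lemma size_cost_visits R st (ws : seq (wpair V * V)) :
  size_cost R st -> (forall w, w \in ws -> w.1.2 = #|w.1.1|) ->
  [/\ size_cost R (visits edgeless R st ws),
      {subset st.1 <= (visits edgeless R st ws).1}
    & (visits edgeless R st ws).2 = None ->
      forall w, w \in ws -> #|w.2 |: w.1.1| <= R ->
      (w.2 |: w.1.1, #|w.2 |: w.1.1|) \in (visits edgeless R st ws).1].
Proof.
elim: ws st => [|x ws IH] st costst costws; first by split.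
have [cost1 sub1 new1] := size_cost_visit costst (costws x (mem_head x ws)).
have costws' w : w \in ws -> w.1.2 = #|w.1.1|.
  by move=> wws; apply: costws; rewrite inE wws orbT.
have [cost2 sub2 new2] := IH _ cost1 costws'.
split=> //= [p /sub1/sub2 //|none w]; rewrite inE => /orP[/eqP->|]; last exact: new2.
move=> leR; apply: sub2; apply: new1 => //.
(* Visits after a return change nothing, so the absence of a return at the end rules one out at the
   first visit. *)
move: none; case: (visit _ _ _ _) => C [r|] // .
by elim: (ws).
Qed.

Definition all_small R C : Prop :=
  forall S, #|S| <= R -> (S, #|S|) \in C.

(** A set [S] of size [R.+1] arises from visiting [S :\ v] with some [v] in [S], unless the
    algorithm returns during the step. *)
Lemma all_small_visits R C (ws : seq (wpair V * V)) :
  size_cost R (C, None) -> all_small R C -> schedule C ws ->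
  size_cost R.+1 (visits edgeless R.+1 (C, None) ws) /\
  all_small R.+1 (visits edgeless R.+1 (C, None) ws).1.
Proof.
move=> [costC _] allC sch.
have costC1 : size_cost R.+1 (C, None).
  by split=> // p /costC[? /leqW].
have [w|cost sub new] := size_cost_visits (ws := ws) costC1.
  by rewrite (mem_schedule sch) => /costC[].
split=> // S; rewrite leq_eqVlt ltnS => /orP[/eqP cardS|/allC/sub //].
have /card_gt0P[v vS] : 0 < #|S| by rewrite cardS.
case E: (visits edgeless R.+1 (C, None) ws).2 => [r|]; last first.
  have := new E ((S :\ v, R), v); rewrite /= setD1K // cardS; apply=> //.
  rewrite (mem_schedule sch) inE /=.
  have cardSv : #|S :\ v| = R by move: cardS; rewrite (cardsD1 v) vS => -[].
  by rewrite -cardSv; apply: allC; rewrite cardSv.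
(* After a return [#|V| <= R.+1], so [S] is the whole vertex set, which has been collected. *)
have VC : ([set: V], #|V|) \in (visits edgeless R.+1 (C, None) ws).1.
  by apply: cost.2; rewrite E.
have [_ /= leV] := cost.1 _ VC.
suff -> : S = [set: V] by rewrite cardsT.
by apply/eqP; rewrite eqEcard subsetT cardsT cardS.
Qed.

Lemma schedule_exists C : exists ws, schedule C ws.
Proof.
exists [seq (p, v) | p <- enum_fset C, v <- enum V].
by exists (enum_fset C), (fun=> enum V).
Qed.

Lemma edgeless_after_step R :
  R < #|V| -> exists2 C, after_step edgeless R (C, None) &
    size_cost R (C, None) /\ all_small R C.
Proof.
elim: R => [_|R IH ltR].
  exists [fset ((set0, 0) : wpair V)]; first exact: After_init.
  split=> [|S]; last by rewrite leqn0 cards_eq0 => /eqP->; rewrite cards0 inE.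
  by split=> // p; rewrite inE => /eqP->; rewrite cards0.
have [C stC [costC allC]] := IH (ltnW ltR); have [ws sch] := schedule_exists C.
have := After_next (ltnW ltR) stC sch.
have [] := all_small_visits costC allC sch.
case: (visits _ _ _ _) => C' [r|] cost all st; last by exists C'.
(* A return in this step would give [#|V| <= R.+1]. *)
have /(cost.1 _)[_ /=] : ([set: V], #|V|) \in C' by apply: cost.2.
by rewrite leqNgt ltR.
Qed.

Lemma edgeless_at_step s :
  0 < s <= #|V| -> exists2 C, at_step edgeless s C & all_small s C.
Proof.
case: s => // s /= lts; have [C stC [costC allC]] := edgeless_after_step lts.
have [ws sch] := schedule_exists C.
have [_ allC'] := all_small_visits costC allC sch.
exists (visits edgeless s.+1 (C, None) ws).1 => //.
by exists C, ws, (size ws); rewrite take_size.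
Qed.

Lemma all_small_card s C :
  all_small s C ->
  \sum_(1 <= i < s.+1) 'C(#|V|, i) <= #|` C `\ ((set0, 0) : wpair V)|.
Proof.
move=> allC; rewrite -card_small_sets cardE.
rewrite -(size_map (fun S => (S, #|S|) : wpair V)); apply: uniq_leq_size.
  by rewrite map_inj_uniq ?enum_uniq // => S T [].
move=> p /mapP[S]; rewrite mem_enum inE => /andP[S_gt0 leS] ->.
rewrite in_fsetD1 allC // andbT.
by apply: contraTneq S_gt0 => -[-> _]; rewrite cards0.
Qed.

End Edgeless.

(** The initial pair is left out of the general count because the edgeless graph collects it besides
    all nonempty small sets, one more than the sum. *)
Theorem theorem2 (V : finType) (s : nat) (hs : 0 < s <= #|V|) :
  (forall e : rel V, symmetric e -> irreflexive e ->
   forall C : front V, at_step e s C ->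
     #|` C `\ ((set0, 0) : wpair V)| <= \sum_(1 <= i < s.+1) 'C(#|V|, i)
     /\ ((exists u v, e u v) -> #|` C| <= \sum_(1 <= i < s.+1) 'C(#|V|, i)))
  /\
  (exists e : rel V, [/\ symmetric e, irreflexive e
   & exists C : front V, at_step e s C /\
     #|` C `\ ((set0, 0) : wpair V)| = \sum_(1 <= i < s.+1) 'C(#|V|, i)]).
Proof.
split=> [e syme irre C /reached_at_step RC|].
  split; first exact: reached_bound RC.
  by apply: (reached_bound_edge syme irre _ RC); case/andP: hs.
exists (@edgeless V); split=> //.
have [C stC allC] := edgeless_at_step hs.
exists C; split=> //; apply/eqP.
by rewrite eqn_leq (reached_bound (reached_at_step stC)) all_small_card.
Qed.
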